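(* Let $K$ be a field, let $n,m\ge 1$, and let $f(X,Y)=\sum_{i=0}^{n}a_{i}Y^{i}$ and $g(X,Y)=\sum_{i=0}^{m}b_{i}Y^{i}$ be polynomials in $K[X,Y]$, with $a_{0},\dots,a_{n},b_{0},\dots,b_{m}\in K[X]$ and $a_{0}a_{n}b_{0}b_{m}\neq 0$. Assume that $f$ and $g$ have no nonconstant factors in $K[X]$, and that $Res_{Y}(f,g)\in K[X]$ is irreducible over $K$. If $$\deg a_{0}>\max\{\deg a_{1},\ldots,\deg a_{n}\}\quad\text{and}\quad \deg b_{m}\geq\max\{\deg b_{0},\ldots,\deg b_{m-1}\},$$ then both $f$ and $g$ are irreducible in $K[X,Y]$. The same conclusion also holds if instead $$\deg a_{0}\geq\max\{\deg a_{1},\ldots,\deg a_{n}\}\quad\text{and}\quad \deg b_{m}>\max\{\deg b_{0},\ldots,\deg b_{m-1}\}.$$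
   Context: $Res_Y(f,g)$ is the resultant of $f$ and $g$ regarded as polynomials in $Y$ with coefficients in $K[X]$. $\deg$ is the degree in $X$, with $\deg 0=-\infty$. *)

(* Defs.v *)
From HB Require Import structures.
From mathcomp Require Import all_boot all_order all_algebra.

Set Implicit Arguments.
Unset Strict Implicit.
Unset Printing Implicit Defensive.

Import GRing.Theory.
Local Open Scope ring_scope.

(* K[X,Y] is {poly {poly K}}: the inner variable is X and the outer one Y,   *)
(* so [resultant] on {poly {poly K}} is Res_Y, with values in K[X].          *)

(* The library's [irreducible_poly] is defined by sizes and pseudo-division, *)
(* which is not irreducibility when the coefficient ring is not a field;     *)
(* K[X,Y] needs the ring-theoretic notion.                                   *)
Definition irreducible_elt (R : idomainType) (p : R) : Prop :=
  [/\ p != 0,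
      p \isn't a GRing.unit &
      forall q r : R, p = q * r ->
        (q \is a GRing.unit) \/ (r \is a GRing.unit)].

Definition no_nonconst_factor_in_X (K : fieldType) (f : {poly {poly K}}) : Prop :=
  forall (d : {poly K}) (h : {poly {poly K}}), f = d%:P * h -> (size d <= 1)%N.

(* Main.v *)
Require Import Defs.
From mathcomp Require Import all_boot all_order all_algebra.
From mathcomp Require Import perm zify.

Set Implicit Arguments.
Unset Strict Implicit.
Unset Printing Implicit Defensive.

Import GRing.Theory.
Local Open Scope ring_scope.

(** The proof compares degrees in X. Write n and m for the degrees of f and g
    in Y, and [degX] for the degree in X. Each row of the Sylvester matrix
    coming from f (there are m of them) has entries of degree at most [degX f],
    and each of the n rows coming from g has entries of degree at most [degX g],
    so Res(f, g) has degree at most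

      [res_bound f g] = m * degX f + n * degX g,

    and the coefficient of Res(f, g) in that degree is the determinant of the
    Sylvester matrix, of the same shape, of the [top_form]s of f and g, that is
    of the coefficients (polynomials in Y) of their highest powers of X
    ([resultant_top]). The degree hypotheses say that one of the two top forms
    is a monomial, and that the end coefficient that matters in the other is not
    zero, so that this matrix is triangular with a nonzero diagonal, and the bound is attained ([size_resultant_const_top],
    [size_resultant_Xn_top]).

    Let g = g1 * g2 with factors that are not units. Both have positive degree in
    Y, because g has no nonconstant factor in K[X]. Then Res(f, g) is the product
    of Res(f, g1) and Res(f, g2) ([resultantM]), and its bound is the sum of
    theirs; as the bound is attained for g, it is attained for g1 and g2. Since
    Res(f, g) is irreducible, one of the two factors, say Res(f, g1), is constant,
    so that m1 * degX f + n * degX g1 = 0, where m1 > 0 is the degree of g1 in Y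
    ([factor_res_bound]). This is impossible if degX f > 0, which is so under the
    first pair of hypotheses. Under the second pair, it puts g1 in K[Y]; then g1
    divides the top form of g, a monomial in Y, although Y does not divide g
    ([no_factor_in_Y_Xn]). For f the roles are exchanged, which multiplies the
    resultant by a unit: degX g > 0 settles the second pair of hypotheses, and in
    the first pair the top form of f is a constant ([no_factor_in_Y_const]). *)

(** * Determinants of families of polynomials *)

Section CoefDet.
Variable R : comNzRingType.
Implicit Types (P Q : nat -> {poly R}) (p q f g h u v : {poly R}).

(** The i-th row holds the coefficients of [P i]. The families are indexed by
    [nat], so that families of sizes such as m1 + m2 + n and m1 + (m2 + n) are
    compared by rewriting the size, without casts between ordinals. *)
Definition coef_det k P : R := \det (\matrix_(i < k, j < k) (P i)`_j).

Lemma eq_coef_det k P Q :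
  (forall i, (i < k)%N -> P i = Q i) -> coef_det k P = coef_det k Q.
Proof.
by move=> ePQ; congr (\det _); apply/matrixP => i j; rewrite !mxE ePQ.
Qed.

(** Multiplying matrices amounts to substituting the family P for the powers of
    the indeterminate in the members of Q; this turns identities between
    polynomials into identities between determinants. *)
Lemma coef_det_mul k P Q :
  coef_det k (fun i => \sum_(j < k) (Q i)`_j *: P j)
    = coef_det k Q * coef_det k P.
Proof.
rewrite -det_mulmx; congr (\det _); apply/matrixP => i j.
rewrite !mxE coef_sum; apply: eq_bigr => l _.
by rewrite !mxE coefZ.
Qed.

Lemma coef_det_lblock k l P :
  (forall i, (i < k)%N -> (size (P i) <= k)%N) ->
  (forall i, (i < l)%N -> (size (P (k + i)%N) <= (k + i).+1)%N) ->
  coef_det (k + l) P = coef_det k P * \prod_(i < l) (P (k + i)%N)`_(k + i).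
Proof.
move=> szu szd; rewrite /coef_det -[X in \det X = _]submxK.
set M := \matrix_(i, j) _.
have -> : ursubmx M = 0.
  apply/matrixP => i j; rewrite !mxE /= nth_default //.
  exact: leq_trans (szu _ (ltn_ord i)) (leq_addr _ _).
rewrite det_lblock; congr (_ * _).
  by congr (\det _); apply/matrixP => i j; rewrite !mxE.
rewrite det_trig; first by apply: eq_bigr => i _; rewrite !mxE.
apply/is_trig_mxP => i j ltij; rewrite !mxE /= nth_default //.
by apply: leq_trans (szd _ (ltn_ord i)) _; rewrite ltn_add2l.
Qed.

Lemma coef_det_lower k P : (forall i, (i < k)%N -> (size (P i) <= i.+1)%N) ->
  coef_det k P = \prod_(i < k) (P i)`_i.
Proof.
by move=> szP; rewrite -[k]add0n coef_det_lblock // /coef_det det_mx00 mul1r.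
Qed.

Lemma coef_det_upper k P :
    (forall i j, (i < k)%N -> (j < i)%N -> (P i)`_j = 0) ->
  coef_det k P = \prod_(i < k) (P i)`_i.
Proof.
move=> P0; rewrite /coef_det -det_tr det_trig.
  by apply: eq_bigr => i _; rewrite !mxE.
by apply/is_trig_mxP => i j ltij; rewrite !mxE P0.
Qed.

(** The powers below l contribute an identity block. *)
Lemma coef_det_Xn l k Q :
  coef_det (l + k) (fun i => if (i < l)%N then 'X^i else 'X^l * Q (i - l)%N)
    = coef_det k Q.
Proof.
rewrite /coef_det -[X in \det X = _]submxK.
set M := \matrix_(i, j) _.
have -> : ulsubmx M = 1%:M.
  apply/matrixP => i j; rewrite !mxE /= ltn_ord coefXn -val_eqE eq_sym.
  by rewrite mulrb.
have -> : dlsubmx M = 0.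
  apply/matrixP => i j; rewrite !mxE /= ltnNge leq_addr /=.
  by rewrite coefXnM ltn_ord.
rewrite det_ublock det1 mul1r; congr (\det _); apply/matrixP => i j.
by rewrite !mxE /= ltnNge leq_addr /= coefXnM ltnNge leq_addr /= !addKn.
Qed.

Definition sylvester_row m f g i : {poly R} :=
  if (i < m)%N then 'X^i * f else 'X^(i - m) * g.

Lemma resultantE f g :
  resultant f g = coef_det ((size g).-1 + (size f).-1)
                           (sylvester_row (size g).-1 f g).
Proof.
rewrite /resultant; congr (\det _); apply/matrixP => i j.
rewrite Sylvester_mxE mxE /sylvester_row.
case: splitP => l ->.
  by rewrite coefXnM ltnNge; case: leqP; rewrite ?mulr1n ?mulr0n.
rewrite addKn coefXnM ltnNge.
by case: leqP; rewrite ?mulr1n ?mulr0n.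
Qed.

Lemma combine_coef k p h : (size p <= k)%N ->
  \sum_(j < k) p`_j *: ('X^j * h) = p * h.
Proof.
move=> szp; rewrite -[in RHS](coefK p) poly_def mulr_suml.
rewrite [RHS](big_ord_widen k (fun j : nat => p`_j *: 'X^j * h)) //.
rewrite [RHS]big_mkcond /=; apply: eq_bigr => j _; rewrite scalerAl.
by case: ltnP => // lepj; rewrite nth_default // scale0r mul0r.
Qed.

(** The Sylvester matrix represents the map that sends (u, v) to u * f + v * g;
    the pair is stored in the single polynomial u + 'X^m * v. *)
Lemma combine_sylvester m n f g u v : (size u <= m)%N -> (size v <= n)%N ->
  \sum_(j < m + n) (u + 'X^m * v)`_j *: sylvester_row m f g j
    = u * f + v * g.
Proof.
move=> szu szv; rewrite big_split_ord /=; congr (_ + _).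
  rewrite -(combine_coef f szu); apply: eq_bigr => j _.
  by rewrite /sylvester_row ltn_ord coefD coefXnM ltn_ord addr0.
rewrite -(combine_coef g szv); apply: eq_bigr => j _.
rewrite /sylvester_row coefD coefXnM ltnNge leq_addr /= addKn.
by rewrite nth_default ?add0r // (leq_trans szu) ?leq_addr.
Qed.

Lemma combine_sylvester_l m n f g u : (size u <= m)%N ->
  \sum_(j < m + n) u`_j *: sylvester_row m f g j = u * f.
Proof.
move=> szu; have := @combine_sylvester m n f g u 0 szu.
by rewrite size_poly0 mul0r !addr0 mulr0 addr0 => ->.
Qed.

Lemma combine_sylvester_r m n f g v : (size v <= n)%N ->
  \sum_(j < m + n) ('X^m * v)`_j *: sylvester_row m f g j = v * g.
Proof.
move=> szv; have := @combine_sylvester m n f g 0 v _ szv.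
by rewrite size_poly0 mul0r !add0r => ->.
Qed.

Lemma size_XnM_leq p i k : (size p <= k)%N -> (size ('X^i * p)%R <= i + k)%N.
Proof.
move=> szp; apply/leq_sizeP => j lej; rewrite coefXnM.
case: ltnP => // leij; rewrite nth_default // (leq_trans szp) //; lia.
Qed.

Lemma size_sylvester_row m n f g i :
    (size f <= n.+1)%N -> (size g <= m.+1)%N -> (i < m + n)%N ->
  (size (sylvester_row m f g i) <= m + n)%N.
Proof.
move=> szf szg lti; rewrite /sylvester_row; case: ltnP => [ltim|leim].
  by apply: leq_trans (size_XnM_leq _ szf) _; lia.
by apply: leq_trans (size_XnM_leq _ szg) _; lia.
Qed.

(** Both sides are the determinant of the family that consists of the
    - 'X^i * f for i < m1,
    - 'X^i * f * g1 for i < m2,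
    - 'X^i * g1 * g2 for i < n.
    On the one hand, it is obtained from the Sylvester family of f and g1 * g2
    by replacing the multipliers of f by the 'X^i with i < m1 and the 'X^i * g1
    with i < m2, a triangular change of basis. On the other hand, it is obtained
    from the family of the 'X^i * f and the 'X^i * g1 by keeping the first m1
    members and replacing the multipliers of g1 by the Sylvester family of f and
    g2. The power of [g1`_m1] comes on the left from the change of basis, and on
    the right from the m2 extra multiples of g1. *)
Lemma sylvester_detM n m1 m2 f g1 g2 :
    (size f <= n.+1)%N -> (size g1 <= m1.+1)%N -> (size g2 <= m2.+1)%N ->
  g1`_m1 ^+ m2 *
    coef_det (m1 + m2 + n) (sylvester_row (m1 + m2) f (g1 * g2))
  = g1`_m1 ^+ m2 * (coef_det (m1 + n) (sylvester_row m1 f g1)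
                    * coef_det (m2 + n) (sylvester_row m2 f g2)).
Proof.
move=> szf szg1 szg2; pose k := (m1 + m2 + n)%N.
pose Q i : {poly R} := if (m1 <= i < m1 + m2)%N then 'X^(i - m1) * g1 else 'X^i.
pose Q' i : {poly R} :=
  if (i < m1)%N then 'X^i else 'X^m1 * sylvester_row m2 f g2 (i - m1).
have detQ : coef_det k Q = g1`_m1 ^+ m2.
  rewrite coef_det_lower; last first.
    move=> i lti; rewrite /Q; case: ifP => [/andP[lei _]|_].
      by apply: leq_trans (size_XnM_leq _ szg1) _; lia.
    by rewrite size_polyXn.
  rewrite /k !big_split_ord /=.
  rewrite big1 ?mul1r => [|i _]; last first.
    by rewrite /Q leqNgt ltn_ord /= coefXn eqxx.
  rewrite [X in _ * X]big1 ?mulr1 => [|i _]; last first.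
    by rewrite /Q [X in _ && X]ltnNge leq_addr andbF coefXn eqxx.
  rewrite -[in RHS](card_ord m2) -prodr_const; apply: eq_bigr => i _.
  rewrite /Q leq_addr ltn_add2l ltn_ord /= addKn coefXnM ifF ?addnK //.
  by rewrite ltnNge leq_addl.
(* There are m2 more multiples of g1 here than in Res(f, g1); each of them
   comes with one new column, where it has the coefficient [g1`_m1]. *)
have detS1 : coef_det k (sylvester_row m1 f g1)
    = coef_det (m1 + n) (sylvester_row m1 f g1) * g1`_m1 ^+ m2.
  rewrite /k addnAC coef_det_lblock; first last.
  - move=> i lti; rewrite /sylvester_row ifF ?ltnNge; last by lia.
    by apply: leq_trans (size_XnM_leq _ szg1) _; lia.
  - by move=> i lti; apply: size_sylvester_row.
  congr (_ * _); rewrite -[in RHS](card_ord m2) -prodr_const.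
  apply: eq_bigr => i _; rewrite /sylvester_row ifF; last by lia.
  rewrite coefXnM ifF; last by lia.
  by congr (_`_ _); lia.
have detQ' : coef_det k Q' = coef_det (m2 + n) (sylvester_row m2 f g2).
  by rewrite /k -addnA coef_det_Xn.
(* What remains is that the two products of matrices have the same rows. *)
rewrite -detQ' mulrA [X in _ = X * _]mulrC -detS1 [RHS]mulrC.
rewrite -[X in X * _ = _]detQ -!coef_det_mul.
apply: eq_coef_det => i ltik; rewrite /Q /Q'.
rewrite [in RHS]/k -addnA; case: (ltnP i m1) => [lti|lei] /=.
  by rewrite !combine_sylvester_l ?size_polyXn //; lia.
rewrite combine_sylvester_r; last by apply: size_sylvester_row => //; lia.
case: (ltnP i (m1 + m2)) => [lti|lei'] /=.
  rewrite combine_sylvester_l; last first.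
    by apply: leq_trans (size_XnM_leq _ szg1) _; lia.
  rewrite /sylvester_row ifT; last by lia.
  by rewrite -!mulrA [g1 * f]mulrC.
have -> : 'X^i = 'X^(m1 + m2) * 'X^(i - (m1 + m2)) :> {poly R}.
  by rewrite -exprD subnKC.
rewrite combine_sylvester_r ?size_polyXn; last by lia.
rewrite /sylvester_row ifF; last by lia.
by rewrite subnDA -mulrA [g1 * g2]mulrC.
Qed.

(** The multiplier is the sign of a permutation of the rows, written as the
    determinant of the permuted powers of the indeterminate. Exchanging f and g
    in the statement shows that the two resultants are associates, without
    computing that sign. *)
Lemma resultant_swap f g : exists c, resultant g f = c * resultant f g.
Proof.
rewrite !resultantE; set n := (size f).-1; set m := (size g).-1.
exists (coef_det (m + n) (fun i => if (i < n)%N then 'X^m * 'X^i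
                                   else 'X^(i - n))).
rewrite -coef_det_mul addnC; apply: eq_coef_det => i lti.
rewrite [in LHS]/sylvester_row; case: ltnP => [ltin|lein].
  by rewrite combine_sylvester_r // size_polyXn.
by rewrite combine_sylvester_l // size_polyXn; lia.
Qed.

End CoefDet.

(** The power of the leading coefficient of g1 in [sylvester_detM] cancels. *)
Lemma resultantM (R : idomainType) (f g1 g2 : {poly R}) : g1 != 0 -> g2 != 0 ->
  resultant f (g1 * g2) = resultant f g1 * resultant f g2.
Proof.
move=> g1n0 g2n0; rewrite !resultantE.
have sz1 : size g1 = (size g1).-1.+1 by rewrite polySpred.
have sz2 : size g2 = (size g2).-1.+1 by rewrite polySpred.
have -> : (size (g1 * g2)).-1 = ((size g1).-1 + (size g2).-1)%N.
  by rewrite size_mul //; lia.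
apply: (@mulfI _ (lead_coef g1 ^+ (size g2).-1)).
  by rewrite expf_neq0 // lead_coef_eq0.
by apply: sylvester_detM; rewrite ?leqSpred.
Qed.

(** * The degree in X of a resultant *)

Lemma coef_prod_top (R : comNzRingType) (I : Type) (r : seq I)
    (F : I -> {poly R}) (d : I -> nat) :
    (forall i, (size (F i) <= (d i).+1)%N) ->
  (size (\prod_(i <- r) F i)%R <= (\sum_(i <- r) d i).+1)%N /\
  (\prod_(i <- r) F i)`_(\sum_(i <- r) d i) = \prod_(i <- r) (F i)`_(d i).
Proof.
move=> szF; elim: r => [|i r [szr cr]].
  by rewrite !big_nil size_poly1 coefC.
rewrite !big_cons; set p := \prod_(j <- r) F j in szr cr *.
set e := (\sum_(j <- r) d j)%N in szr cr *.
split.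
  by apply: leq_trans (size_polyMleq _ _) _; have := szF i; lia.
rewrite coefM (bigD1 (inord (d i))) //= inordK ?ltnS ?leq_addr //.
rewrite addKn cr [X in _ + X]big1 ?addr0 // => j nej.
have [ltj|lej] := ltnP (d i) j.
  by rewrite nth_default ?mul0r // (leq_trans (szF i)).
rewrite [X in _ * X]nth_default ?mulr0 //; apply: leq_trans szr _.
have ltj : (j < d i)%N.
  rewrite ltn_neqAle lej andbT; apply: contra nej => /eqP eqj.
  by rewrite -val_eqE /= inordK ?eqj // ltnS leq_addr.
lia.
Qed.

(** The degree bounds depend on the row only, so every term of the Leibniz
    expansion has the same bound, and taking the coefficients at the bounds
    commutes with the determinant. *)
Lemma coef_det_top (R : comNzRingType) k (M : 'M[{poly R}]_k) (d : 'I_k -> nat) :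
    (forall i j, (size (M i j) <= (d i).+1)%N) ->
  (size (\det M) <= (\sum_i d i).+1)%N /\
  (\det M)`_(\sum_i d i) = \det (\matrix_(i, j) (M i j)`_(d i)).
Proof.
move=> szM.
have top (s : 'S_k) := @coef_prod_top R _ (index_enum 'I_k) (fun i => M i (s i)) d
               (fun i => szM i (s i)).
split.
  apply: leq_trans (size_sum _ _ _) _; apply/bigmax_leqP => s _.
  rewrite -signr_odd; case: odd; rewrite ?expr1 ?expr0 ?mulN1r ?mul1r ?size_polyN.
    by case: (top s).
  by case: (top s).
rewrite /determinant coef_sum; apply: eq_bigr => s _.
have -> : \prod_i (\matrix_(i, j) (M i j)`_(d i)) i (s i)
    = \prod_i (M i (s i))`_(d i) by apply: eq_bigr => i _; rewrite mxE.
rewrite -(top s).2 -signr_odd -[in RHS]signr_odd.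
by case: (odd _); rewrite ?expr1 ?expr0 ?mulN1r ?mul1r ?coefN.
Qed.

Section Bivariate.
Variable K : fieldType.
Implicit Types (f g u : {poly {poly K}}) (h : {poly K}).

Definition degX f : nat := (sizeY f).-1.
Definition degY f : nat := (size f).-1.

(** The coefficient, in K[Y], of the highest power of X. *)
Definition top_form f : {poly K} := lead_coef (swapXY f).

Lemma coef_top_form f i : (top_form f)`_i = f`_i`_(degX f).
Proof. by rewrite /top_form lead_coefE coef_swapXY /degX sizeYE. Qed.

Lemma size_coef_degX f i : (size (f`_i)%R <= (degX f).+1)%N.
Proof. exact: leq_trans (max_size_coefXY f i) (leqSpred _). Qed.

Lemma degX_mul f g : f != 0 -> g != 0 -> degX (f * g) = (degX f + degX g)%N.
Proof.
rewrite -[f == 0]swapXY_eq0 -[g == 0]swapXY_eq0 => f0 g0.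
rewrite /degX !sizeYE rmorphM /= size_mul // (polySpred f0) (polySpred g0).
by rewrite addSn addnS.
Qed.

Lemma degY_mul f g : f != 0 -> g != 0 -> degY (f * g) = (degY f + degY g)%N.
Proof.
move=> f0 g0; rewrite /degY size_mul // (polySpred f0) (polySpred g0).
by rewrite addSn addnS.
Qed.

(** The sum, over the rows of the Sylvester matrix, of the degree in X of the
    polynomial that fills the row. *)
Definition res_bound f g : nat := (degY g * degX f + degY f * degX g)%N.

(** A top form may have lower degree in Y than the polynomial it comes from, so
    the right-hand side is a Sylvester determinant with prescribed formal
    degrees, and it can differ from the resultant of the top forms. *)
Lemma resultant_top f g :
  (size (resultant f g) <= (res_bound f g).+1)%N /\
  (resultant f g)`_(res_bound f g)
    = coef_det (degY g + degY f)
               (sylvester_row (degY g) (top_form f) (top_form g)).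
Proof.
rewrite resultantE -/(degY f) -/(degY g); set m := degY g; set n := degY f.
pose d (i : 'I_(m + n)) : nat := if (i < m)%N then degX f else degX g.
have -> : res_bound f g = (\sum_i d i)%N.
  rewrite big_split_ord /=.
  rewrite (eq_bigr (fun=> degX f)) => [|i _]; last by rewrite /d /= ltn_ord.
  rewrite [X in _ = (_ + X)%N](eq_bigr (fun=> degX g)) => [|i _]; last first.
    by rewrite /d /= ltnNge leq_addr.
  by rewrite !sum_nat_const !card_ord.
have [|szM ->] := @coef_det_top K _
    (\matrix_(i < m + n, j < m + n) (sylvester_row m f g i)`_j) d.
  move=> i j; rewrite mxE /sylvester_row /d.
  by case: ltnP => _; rewrite coefXnM; case: ifP;
    rewrite ?size_poly0 ?size_coef_degX.
split=> //; congr (\det _); apply/matrixP => i j; rewrite !mxE /sylvester_row /d.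
by case: ltnP => _; rewrite !coefXnM; case: ifP;
  rewrite ?coef0 ?coef_top_form.
Qed.

Lemma resultant_eqp_swap f g : resultant g f %= resultant f g.
Proof.
have [c Ec] := resultant_swap f g; have [c' Ec'] := resultant_swap g f.
by apply/andP; split; [rewrite Ec' | rewrite Ec]; apply: dvdp_mull.
Qed.

Lemma irreducible_eqp (p q : {poly K}) :
  p %= q -> irreducible_poly p -> irreducible_poly q.
Proof.
move=> epq [szp irrp]; split=> [|r nr rq]; first by rewrite -(eqp_size epq).
by apply: (eqp_trans _ epq); apply: irrp => //; rewrite (eqp_dvdr _ epq).
Qed.

(** * Irreducibility from the degree of the resultant *)

Definition no_nonconst_factor_in_Y f : Prop :=
  forall h u, f = h^:P * u -> (size h <= 1)%N.

Lemma top_formM h u : top_form (h^:P * u) = h * top_form u.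
Proof. by rewrite /top_form rmorphM /= swapXY_map_polyC lead_coefM lead_coefC. Qed.

Lemma no_factor_in_Y_const f : size (top_form f) = 1%N ->
  no_nonconst_factor_in_Y f.
Proof.
move=> sz1 h u fE; rewrite -sz1 dvdp_leq //.
  by rewrite -size_poly_eq0 sz1.
by rewrite fE top_formM dvdp_mulr.
Qed.

(** A factor in K[Y] divides the top form, hence is a power of Y up to a
    constant, but Y does not divide f. *)
Lemma no_factor_in_Y_Xn f c m : c != 0 -> top_form f = c *: 'X^m -> f`_0 != 0 ->
  no_nonconst_factor_in_Y f.
Proof.
move=> c0 fT f0 h u fE.
have hdvd : h %| 'X^m.
  by rewrite -(dvdpZr _ _ c0) -fT fE top_formM dvdp_mulr.
have hcop : coprimep h 'X^m.
  apply: coprimep_expr; rewrite coprimepX /root horner_coef0.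
  apply: contra f0 => /eqP h0; rewrite fE coef0M coef_map /= h0.
  by rewrite polyC0 mul0r.
have := coprimep_dvdl hdvd hcop; rewrite coprimepp.
by move/eqP ->.
Qed.

(** The degree of Res(f, g1 * g2) is the sum of the bounds of its two factors
    Res(f, g1) and Res(f, g2), so each of these attains its bound; one of them
    is constant by irreducibility. *)
Lemma factor_res_bound f g1 g2 :
    g1 != 0 -> g2 != 0 -> irreducible_poly (resultant f (g1 * g2)) ->
    size (resultant f (g1 * g2)) = (res_bound f (g1 * g2)).+1 ->
  res_bound f g1 = 0%N \/ res_bound f g2 = 0%N.
Proof.
move=> g1n0 g2n0 irrR szR.
have bD : res_bound f (g1 * g2) = (res_bound f g1 + res_bound f g2)%N.
  by rewrite /res_bound degX_mul // degY_mul //; lia.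
have [sz1 _] := resultant_top f g1; have [sz2 _] := resultant_top f g2.
have Rn0 := irredp_neq0 irrR.
have RM := resultantM f g1n0 g2n0.
move: (Rn0); rewrite RM mulf_eq0 negb_or => /andP[r1 r2].
have szM : size (resultant f (g1 * g2))
    = (size (resultant f g1) + size (resultant f g2)).-1.
  by rewrite RM size_mul.
have [s1|n1] := eqVneq (size (resultant f g1)) 1%N; first by left; lia.
right; have := irrR.2 _ n1; rewrite {1}RM dvdp_mulr // => /(_ isT) /eqp_size.
move=> szE; have : ((res_bound f g1 + res_bound f g2).+1 <= (res_bound f g1).+1)%N.
  by rewrite -bD -szR -szE.
lia.
Qed.

(** If the bound of a factor g1 vanishes, then degX g1 = 0, that is g1 is in K[Y],
    and moreover degX f = 0 or g1 is constant in Y; the last hypothesis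
    makes g1 constant in Y in either case. *)
Lemma factor_irreducible f g :
    (0 < degY f)%N -> (0 < degY g)%N ->
    no_nonconst_factor_in_X g -> irreducible_poly (resultant f g) ->
    size (resultant f g) = (res_bound f g).+1 ->
    (0 < degX f)%N \/ no_nonconst_factor_in_Y g ->
  irreducible_elt g.
Proof.
move=> nf mg gX irrR szR gY.
have gn0 : g != 0 by apply: contraTneq mg => ->; rewrite /degY size_poly0.
have no_bound0 g1 g2 : g = g1 * g2 -> g1 != 0 -> (1 < size g1)%N ->
    res_bound f g1 <> 0%N.
  move=> gE g10 sz1 /eqP; rewrite addn_eq0 !muln_eq0 => /andP[].
  rewrite [degY f == 0%N]gtn_eqF //= => b1 /eqP b2.
  case: gY => [dX|gY]; first by move: b1; rewrite /degY; lia.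
  have szY : (size (swapXY g1) <= 1)%N by move: b2; rewrite /degX sizeYE; lia.
  have g1E : g1 = ((swapXY g1)`_0)^:P.
    by rewrite -swapXY_polyC -(size1_polyC szY) swapXYK.
  have : (size ((swapXY g1)`_0)%R <= 1)%N by apply: (gY _ g2); rewrite -g1E.
  by rewrite leqNgt -(size_map_polyC (swapXY g1)`_0) -g1E sz1.
have const_unit g1 g2 : g = g1 * g2 -> (size g1 <= 1)%N ->
    g1 \is a GRing.unit.
  move=> gE sz1.
  have c1 : g1 = (g1`_0)%:P by apply: size1_polyC.
  have szc : (size (g1`_0)%R <= 1)%N by apply: (gX _ g2); rewrite -c1.
  have g10 : g1 != 0 by apply: contraNneq gn0 => g10; rewrite gE g10 mul0r.
  have c0 : g1`_0 != 0 by move: g10; rewrite {1}c1 polyC_eq0.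
  rewrite poly_unitE eqn_leq sz1 lt0n size_poly_eq0 g10 /=.
  rewrite poly_unitE eqn_leq szc lt0n size_poly_eq0 c0 /= unitfE.
  by move: c0; rewrite {1}(size1_polyC szc) polyC_eq0.
split=> // [|g1 g2 gE].
  by rewrite poly_unitE; move: mg; rewrite /degY; case: eqP => // ->.
have gE' : g = g2 * g1 by rewrite mulrC.
have [sz1|sz1] := leqP (size g1) 1; first by left; apply: const_unit gE sz1.
have [sz2|sz2] := leqP (size g2) 1; first by right; apply: const_unit gE' sz2.
have g10 : g1 != 0 by rewrite -size_poly_gt0; apply: leq_trans sz1.
have g20 : g2 != 0 by rewrite -size_poly_gt0; apply: leq_trans sz2.
have := @factor_res_bound f g1 g2 g10 g20; rewrite -gE => /(_ irrR szR)[].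
  by move/(no_bound0 _ _ gE g10 sz1).
by move/(no_bound0 _ _ gE' g20 sz2).
Qed.

Lemma irreducible_pair f g :
    (0 < degY f)%N -> (0 < degY g)%N ->
    no_nonconst_factor_in_X f -> no_nonconst_factor_in_X g ->
    irreducible_poly (resultant f g) ->
    size (resultant f g) = (res_bound f g).+1 ->
    (0 < degX g)%N \/ no_nonconst_factor_in_Y f ->
    (0 < degX f)%N \/ no_nonconst_factor_in_Y g ->
  irreducible_elt f /\ irreducible_elt g.
Proof.
move=> nf mg fX gX irrR szR fY gY.
have eR := resultant_eqp_swap f g.
split; last exact: factor_irreducible nf mg gX irrR szR gY.
apply: factor_irreducible mg nf fX _ _ fY.
  by apply: irreducible_eqp irrR; rewrite eqp_sym.
by rewrite (eqp_size eR) szR /res_bound addnC.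
Qed.

(** * The top coefficient determinant under the dominance hypotheses *)

Lemma size_resultant_top f g :
    coef_det (degY g + degY f)
             (sylvester_row (degY g) (top_form f) (top_form g)) != 0 ->
  size (resultant f g) = (res_bound f g).+1.
Proof.
have [szR cR] := resultant_top f g; rewrite -cR => nz.
apply/eqP; rewrite eqn_leq szR ltnNge /=; apply: contra nz => le.
by rewrite nth_default.
Qed.

Lemma size_top_form f : (size (top_form f) <= (degY f).+1)%N.
Proof.
apply: leq_trans (leqSpred _); apply/leq_sizeP => j lej.
by rewrite coef_top_form (nth_default 0 lej) coef0.
Qed.

(** In the matrix of the top forms, the rows of f have only their diagonal entry,
    and those of g end on the diagonal with a nonzero coefficient: the matrix is
    lower triangular. *)
Lemma size_resultant_const_top f g :
    size (top_form f) = 1%N -> (top_form g)`_(degY g) != 0 ->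
  size (resultant f g) = (res_bound f g).+1.
Proof.
move=> szf gm; apply: size_resultant_top; rewrite coef_det_lower.
  apply/prodf_neq0 => i _; rewrite /sylvester_row; case: ltnP => [_|lei].
    rewrite coefXnM ltnn subnn; apply/eqP => f0.
    by move: (szf); rewrite (size1_polyC (eq_leq szf)) f0 size_poly0.
  by rewrite coefXnM ltnNge leq_subr /= subKn.
move=> i lti; rewrite /sylvester_row; case: ltnP => [_|lei].
  by rewrite -addn1; apply: size_XnM_leq; rewrite szf.
by apply: leq_trans (size_XnM_leq _ (size_top_form g)) _; lia.
Qed.

(** In the matrix of the top forms, the rows of g have only their diagonal entry,
    and those of f start on the diagonal with a nonzero coefficient: the matrix
    is upper triangular. *)
Lemma size_resultant_Xn_top f g c :
    (top_form f)`_0 != 0 -> c != 0 -> top_form g = c *: 'X^(degY g) ->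
  size (resultant f g) = (res_bound f g).+1.
Proof.
move=> f0 c0 gE; apply: size_resultant_top; rewrite coef_det_upper.
  apply/prodf_neq0 => i _; rewrite /sylvester_row; case: ltnP => [_|lei].
    by rewrite coefXnM ltnn subnn.
  by rewrite gE -scalerAr -exprD subnK // coefZ coefXn eqxx mulr1.
move=> i j lti ltj; rewrite /sylvester_row; case: ltnP => [_|lei].
  by rewrite coefXnM ltj.
by rewrite gE -scalerAr -exprD subnK // coefZ coefXn ltn_eqF // mulr0.
Qed.

Lemma degX_dominant f k : (forall i, (size (f`_i)%R <= size (f`_k)%R)%N) ->
  degX f = (size (f`_k)%R).-1.
Proof.
move=> dom; congr _.-1; apply/eqP; rewrite eqn_leq max_size_coefXY andbT.
by apply/bigmax_leqP => i _.
Qed.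

Lemma top_form_dominant f k : (forall i, (size (f`_i)%R <= size (f`_k)%R)%N) ->
  (top_form f)`_k = lead_coef f`_k.
Proof. by move=> dom; rewrite coef_top_form (degX_dominant dom). Qed.

Lemma top_form_strictly_dominant f k :
    (forall i, i != k -> (size (f`_i)%R < size (f`_k)%R)%N) ->
  top_form f = lead_coef f`_k *: 'X^k.
Proof.
move=> sdom; have dom i : (size (f`_i)%R <= size (f`_k)%R)%N.
  by have [->|/sdom/ltnW] := eqVneq i k.
apply/polyP => i; rewrite coefZ coefXn coef_top_form (degX_dominant dom).
have [->|/sdom ltik] := eqVneq i k; first by rewrite mulr1.
by rewrite mulr0 nth_default // -ltnS (leq_trans ltik) ?leqSpred.
Qed.

End Bivariate.

(* size p = deg p + 1 with size 0 = 0, so comparing sizes compares degrees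
   under the convention that deg 0 is minus infinity *)
Theorem theoremD (K : fieldType) (n m : nat) (a b : nat -> {poly K})
    (f g : {poly {poly K}})
    (n_ge1 : (1 <= n)%N) (m_ge1 : (1 <= m)%N)
    (fE : f = \sum_(i < n.+1) a i *: 'X^i)
    (gE : g = \sum_(i < m.+1) b i *: 'X^i)
    (ab_neq0 : a 0%N * a n * b 0%N * b m != 0)
    (f_nofact : no_nonconst_factor_in_X f)
    (g_nofact : no_nonconst_factor_in_X g)
    (res_irr : irreducible_poly (resultant f g))
    (deg_cond :
         ((\max_(1 <= i < n.+1) size (a i) < size (a 0))%N /\
          (\max_(0 <= i < m) size (b i) <= size (b m))%N)
      \/ ((\max_(1 <= i < n.+1) size (a i) <= size (a 0))%N /\
          (\max_(0 <= i < m) size (b i) < size (b m))%N)) :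
  irreducible_elt f /\ irreducible_elt g.
Proof.
move: ab_neq0; rewrite !mulf_eq0 !negb_or -!andbA => /and4P[a0 an b0 bm].
rewrite -poly_def in fE; rewrite -poly_def in gE.
have fi i : f`_i = if (i < n.+1)%N then a i else 0 by rewrite fE coef_poly.
have gi i : g`_i = if (i < m.+1)%N then b i else 0 by rewrite gE coef_poly.
have f0 : f`_0 = a 0%N by rewrite fi.
have gm : g`_m = b m by rewrite gi ltnSn.
have Yf : degY f = n by rewrite /degY fE size_poly_eq.
have Yg : degY g = m by rewrite /degY gE size_poly_eq.
have fbound i : i != 0%N ->
    (size (f`_i)%R <= \max_(1 <= j < n.+1) size (a j))%N.
  rewrite fi -lt0n => i0; case: ltnP => [lti|_]; last by rewrite size_poly0.
  by apply: (@leq_bigmax_seq _ _ _ (fun j => size (a j))); rewrite // mem_index_iota i0.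
have gbound i : i != m ->
    (size (g`_i)%R <= \max_(0 <= j < m) size (b j))%N.
  rewrite gi => im; case: ltnP => [lti|_]; last by rewrite size_poly0.
  apply: (@leq_bigmax_seq _ _ _ (fun j => size (b j))); rewrite // mem_index_iota /=.
  by rewrite ltn_neqAle im.
have fdom i : (size (f`_i)%R <= size (f`_0)%R)%N.
  have [->//|/fbound le] := eqVneq i 0%N; apply: leq_trans le _.
  by rewrite f0; case: deg_cond => [[/ltnW]|[]].
have gdom i : (size (g`_i)%R <= size (g`_m)%R)%N.
  have [->//|/gbound le] := eqVneq i m; apply: leq_trans le _.
  by rewrite gm; case: deg_cond => [[_]|[_ /ltnW]].
have f0n : lead_coef f`_0 != 0 by rewrite f0 lead_coef_eq0.
have gmn : lead_coef g`_m != 0 by rewrite gm lead_coef_eq0.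
have Xf : degX f = (size (a 0)).-1 by rewrite (degX_dominant fdom) f0.
have Xg : degX g = (size (b m)).-1 by rewrite (degX_dominant gdom) gm.
case: deg_cond => -[fcond gcond].
- have Lf : size (top_form f) = 1%N.
    rewrite (@top_form_strictly_dominant _ f 0) => [|i /fbound le].
      by rewrite expr0 alg_polyC size_polyC f0n.
    by rewrite f0; apply: leq_ltn_trans le _.
  apply: irreducible_pair; rewrite ?Yf ?Yg //.
  + by apply: size_resultant_const_top; rewrite // Yg top_form_dominant.
  + by right; apply: no_factor_in_Y_const.
  (* The degree of [a 0] exceeds that of [a n], which is nonzero. *)
  left; rewrite Xf.
  have : (0 < size (f`_n)%R)%N by rewrite fi ltnSn size_poly_gt0.
  have := fbound n; rewrite -lt0n => /(_ n_ge1) le lt0.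
  by have := leq_ltn_trans (leq_trans lt0 le) fcond; case: (size _) => [|[]].
have Lg : top_form g = lead_coef g`_m *: 'X^m.
  apply: top_form_strictly_dominant => i /gbound le.
  by rewrite gm; apply: leq_ltn_trans le _.
apply: irreducible_pair; rewrite ?Yf ?Yg //.
+ apply: size_resultant_Xn_top gmn _; first by rewrite top_form_dominant.
  by rewrite Yg.
+ (* The degree of [b m] exceeds that of [b 0], which is nonzero. *)
  left; rewrite Xg.
  have : (0 < size (g`_0)%R)%N by rewrite gi size_poly_gt0.
  have := gbound 0%N; rewrite eq_sym -lt0n => /(_ m_ge1) le lt0.
  by have := leq_ltn_trans (leq_trans lt0 le) gcond; case: (size _) => [|[]].
by right; apply: no_factor_in_Y_Xn gmn Lg _; rewrite gi.
Qed.
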